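(* Let $$Z_R=\left\{x\in\mathbb{R}^n:\ \frac{\delta}{\epsilon}\|a(x)\|_*+a(x)^\top\zeta_i^j\le b_i(x),\ \forall j\in[N],\ i\in[I]\right\},$$ and let $Z_{\mathrm{CVaR}}$ be the set of all $x\in\mathbb{R}^n$ for which there exist $\nu\ge0$, $\gamma\ge0$ and $z\in\mathbb{R}^N$ such that $$\begin{aligned} &\delta\nu-\epsilon\gamma\le\frac1N\sum_{j\in[N]}z_j,\\ &z_j+\gamma\le b_i(x)-a(x)^\top\zeta_i^j,&&\forall j\in[N],\ i\in[I],\\ &z_j\le0,&&\forall j\in[N],\\ &\|a(x)\|_*\le\nu. \end{aligned}$$ Then $Z_R\subseteq Z_{\mathrm{CVaR}}$.
   Context: Let $n,I,N$ be positive integers, $[R]:=\{1,\dots,R\}$, $\epsilon\in(0,1)$, $\delta>0$. Let $\eta_1,\eta_2\in\{0,1\}$ with $\eta_1+\eta_2\ge1$. For $x\in\mathbb{R}^n$ let $a(x)=\begin{pmatrix}\eta_1x\\ \eta_2\end{pmatrix}\in\mathbb{R}^{n+1}$ and, for $i\in[I]$, $b_i(x)=B_i^\top x+b^i$ with given $B_i\in\mathbb{R}^n$, $b^i\in\mathbb{R}$. Let $\|\cdot\|_*$ be the dual norm on $\mathbb{R}^{n+1}$ of a given norm, and let $\zeta_i^j\in\mathbb{R}^{n+1}$, $i\in[I]$, $j\in[N]$, be given sample vectors. *)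

(* Defs.v *)
From mathcomp Require Import all_boot all_order all_algebra.
From mathcomp Require Import boolp classical_sets reals.

Set Implicit Arguments.
Unset Strict Implicit.
Unset Printing Implicit Defensive.

Import Order.TTheory GRing.Theory Num.Theory.

Local Open Scope classical_set_scope.
Local Open Scope ring_scope.

(* Nonnegativity and [nu 0 = 0] follow from these axioms. *)
Definition is_norm (R : realType) (V : lmodType R) (nu : V -> R) : Prop :=
  [/\ forall u v, nu (u + v) <= nu u + nu v,
      forall (c : R) v, nu (c *: v) = `|c| * nu v
    & forall v, nu v = 0 -> v = 0].

Definition dotv (R : realType) (m : nat) (u v : 'cV[R]_m) : R :=
  (u^T *m v) 0 0.

(* [sup] is [0] on sets that are unbounded above, but when [nu] is a norm the
   set below is bounded, since all norms on R^m are equivalent. *)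
Definition dual_norm (R : realType) (m : nat) (nu : 'cV[R]_m -> R)
    (y : 'cV[R]_m) : R :=
  sup [set dotv y v | v in [set v | nu v <= 1]].

Definition avec (R : realType) (n : nat) (eta1 eta2 : R) (x : 'cV[R]_n) :
    'cV[R]_(n + 1) :=
  col_mx (eta1 *: x) (const_mx eta2).

Definition bfun (R : realType) (n I : nat) (B : 'I_I -> 'cV[R]_n)
    (b0 : 'I_I -> R) (i : 'I_I) (x : 'cV[R]_n) : R :=
  dotv (B i) x + b0 i.

Definition Z_R (R : realType) (n I N : nat) (eps delta eta1 eta2 : R)
    (B : 'I_I -> 'cV[R]_n) (b0 : 'I_I -> R) (nrm : 'cV[R]_(n + 1) -> R)
    (zeta : 'I_I -> 'I_N -> 'cV[R]_(n + 1)) : set 'cV[R]_n :=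
  [set x | forall (j : 'I_N) (i : 'I_I),
     delta / eps * dual_norm nrm (avec eta1 eta2 x)
       + dotv (avec eta1 eta2 x) (zeta i j) <= bfun B b0 i x].

Definition Z_CVaR (R : realType) (n I N : nat) (eps delta eta1 eta2 : R)
    (B : 'I_I -> 'cV[R]_n) (b0 : 'I_I -> R) (nrm : 'cV[R]_(n + 1) -> R)
    (zeta : 'I_I -> 'I_N -> 'cV[R]_(n + 1)) : set 'cV[R]_n :=
  [set x | exists (nu gamma : R) (z : 'cV[R]_N),
     0 <= nu /\ 0 <= gamma /\
     delta * nu - eps * gamma <= N%:R^-1 * \sum_(j < N) z j 0 /\
     (forall (j : 'I_N) (i : 'I_I),
        z j 0 + gamma
          <= bfun B b0 i x - dotv (avec eta1 eta2 x) (zeta i j)) /\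
     (forall j : 'I_N, z j 0 <= 0) /\
     dual_norm nrm (avec eta1 eta2 x) <= nu].

(* Main.v *)
Require Import Defs.
From mathcomp Require Import all_boot all_order all_algebra.
From mathcomp Require Import boolp classical_sets reals.

Set Implicit Arguments.
Unset Strict Implicit.
Unset Printing Implicit Defensive.

Import Order.TTheory GRing.Theory Num.Theory.

Local Open Scope classical_set_scope.
Local Open Scope ring_scope.

(** A point [x] of [Z_R] is feasible for the constraints of [Z_CVaR] with
    [z = 0].  Take [nu] to be the dual norm of [a(x)]; the least [gamma] that
    the budget constraint [delta * nu - eps * gamma <= 0] then allows is
    [delta / eps * nu], and for this [gamma] the sample constraints
    [gamma <= b_i(x) - a(x)^T zeta_i^j] are exactly those of [Z_R].  The sign
    conditions on [nu] and [gamma] hold because a dual norm is nonnegative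
    ([dual_norm_ge0]). *)

Lemma is_norm0 (R : realType) (V : lmodType R) (nu : V -> R) :
  is_norm nu -> nu 0 = 0.
Proof. by case=> _ nuZ _; rewrite -(scale0r (0 : V)) nuZ normr0 mul0r. Qed.

(** The origin lies in the unit ball, so the supremum is taken over a set that
    contains [0]; if that set is unbounded above, [sup] returns [0]. *)
Lemma dual_norm_ge0 (R : realType) (m : nat) (nu : 'cV[R]_m -> R) y :
  nu 0 <= 1 -> 0 <= dual_norm nu y.
Proof.
move=> nu0; rewrite /dual_norm; set S := (X in sup X).
have S0 : S 0 by exists 0 => //; rewrite /dotv mulmx0 mxE.
have [supS|/sup_out -> //] := pselect (has_sup S).
exact: sup_upper_bound.
Qed.

Theorem proposition6 (R : realType) (n I N : nat)
    (hn : (0 < n)%N) (hI : (0 < I)%N) (hN : (0 < N)%N)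
    (eps delta : R) (heps : 0 < eps < 1) (hdelta : 0 < delta)
    (eta1 eta2 : R) (heta1 : eta1 = 0 \/ eta1 = 1)
    (heta2 : eta2 = 0 \/ eta2 = 1) (heta : 1 <= eta1 + eta2)
    (B : 'I_I -> 'cV[R]_n) (b0 : 'I_I -> R)
    (nrm : 'cV[R]_(n + 1) -> R) (hnrm : is_norm nrm)
    (zeta : 'I_I -> 'I_N -> 'cV[R]_(n + 1)) :
  Z_R eps delta eta1 eta2 B b0 nrm zeta
    `<=` Z_CVaR eps delta eta1 eta2 B b0 nrm zeta.
Proof.
have [eps_gt0 _] := andP heps.
move=> x xZ; set nu := dual_norm nrm (avec eta1 eta2 x).
have nu_ge0 : 0 <= nu by apply: dual_norm_ge0; rewrite is_norm0.
exists nu, (delta / eps * nu), 0; split=> //; split; last split; last split.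
- by rewrite mulr_ge0 // divr_ge0 // ltW.
- rewrite big1 => [|j _]; last by rewrite mxE.
  by rewrite mulr0 mulrA mulrCA divff ?gt_eqF // mulr1 subrr.
- by move=> j i; rewrite mxE add0r lerBrDr; exact: xZ.
- by split=> // j; rewrite mxE.
Qed.
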